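(* Let $g:\mathbb{R}\to\mathbb{R}$ be non-decreasing and left continuous and let $a,b\in\mathbb{R}$ with $a<b$. The embedding of $W_g^{1,p}([a,b))$ into $\operatorname{BC}_g([a,b])$ is compact for all $p\in(1,\infty]$.
   Context: $\mathbb{F}$ is $\mathbb{R}$ or $\mathbb{C}$; all functions are $\mathbb{F}$-valued. $\mu_g$ is the Lebesgue–Stieltjes measure of $g$, with $\mu_g([x,y))=g(y)-g(x)$, and $L^p_g(I)$ is the $L^p$ space of $\mu_g$ on $I$. For $p\in[1,\infty]$, the Stieltjes–Sobolev space is $$W_g^{1,p}([a,b))=\Big\{u\in L^p_g([a,b)):\ \exists\,\widetilde u\in L^p_g([a,b)),\ u(x)=u(a)+\int_{[a,x)}\widetilde u(s)\,\mathrm{d}\mu_g(s)\ \ \forall x\in[a,b]\Big\},$$ its elements being regarded as functions on $[a,b]$ satisfying this identity, with norm $\|u\|_{W_g^{1,p}}=\|u\|_{L^p_g([a,b))}+\|\widetilde u\|_{L^p_g([a,b))}$. A function $f:[a,b]\to\mathbb{F}$ is $g$-continuous if for every $t\in[a,b]$ and $\varepsilon>0$ there is $\delta>0$ such that $|f(t)-f(s)|<\varepsilon$ for all $s\in[a,b]$ with $|g(t)-g(s)|<\delta$; $\operatorname{BC}_g([a,b])$ is the Banach space of bounded $g$-continuous functions on $[a,b]$ with the supremum norm. One has $W_g^{1,p}([a,b))\subset\operatorname{BC}_g([a,b])$.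
   Formalization: The hypothesis g(a) < g(b) is added: if g(a) = g(b), then W_g^{1,p}([a,b)) consists of all constant functions, each of norm 0, so the norm is not a norm and the embedding is not even bounded. *)

(* Defs.v *)
From HB Require Import structures.
From mathcomp Require Import all_boot all_order all_algebra.
From mathcomp Require Import complex.
From mathcomp Require Import all_classical all_reals all_analysis.

Set Implicit Arguments.
Unset Strict Implicit.
Unset Printing Implicit Defensive.

Import Order.TTheory GRing.Theory Num.Theory.
Import numFieldNormedType.Exports.

Local Open Scope classical_set_scope.
Local Open Scope ring_scope.

(* [scalar_field R k] is the field F of scalars, either R itself or R[i]. *)
Variant scalar_kind := RealScalars | ComplexScalars.

Definition scalar_field (R : realType) (k : scalar_kind) : numFieldType :=
  match k with
  | RealScalars => R
  | ComplexScalars => R[i]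
  end.

Section scalar_field.
Context {R : realType}.

Definition scalar_Re {k : scalar_kind} : scalar_field R k -> R :=
  match k return scalar_field R k -> R with
  | RealScalars => fun z => z
  | ComplexScalars => @complex.Re R
  end.

Definition scalar_Im {k : scalar_kind} : scalar_field R k -> R :=
  match k return scalar_field R k -> R with
  | RealScalars => fun=> 0
  | ComplexScalars => @complex.Im R
  end.

(* x + iy; when F = R the argument y is ignored (it is always 0 below). *)
Definition scalar_mk {k : scalar_kind} : R -> R -> scalar_field R k :=
  match k return R -> R -> scalar_field R k with
  | RealScalars => fun x _ => x
  | ComplexScalars => @Complex R
  end.

(* The norm of a numFieldType is valued in the field itself; [modulus] is the
   same absolute value, seen as an element of R (see [modulusE]). *)
Definition modulus {k : scalar_kind} (z : scalar_field R k) : R := scalar_Re `|z|.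

Lemma modulusE k (z : scalar_field R k) : scalar_mk (modulus z) 0 = `|z|.
Proof. by case: k z => //= -[x y]. Qed.

Lemma scalar_mkK k (x : R) : scalar_Re (scalar_mk x 0 : scalar_field R k) = x.
Proof. by case: k. Qed.

Lemma scalar_mk0 k : scalar_mk 0 0 = 0 :> scalar_field R k.
Proof. by case: k. Qed.

Lemma scalar_mkD k (x y : R) :
  scalar_mk (x + y) 0 = scalar_mk x 0 + scalar_mk y 0 :> scalar_field R k.
Proof. by case: k => //=; exact: (rmorphD (real_complex R)). Qed.

Lemma scalar_mkM k (x y : R) :
  scalar_mk (x * y) 0 = scalar_mk x 0 * scalar_mk y 0 :> scalar_field R k.
Proof. by case: k => //=; exact: (rmorphM (real_complex R)). Qed.

Lemma ler_scalar_mk k (x y : R) :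
  ((scalar_mk x 0 : scalar_field R k) <= scalar_mk y 0) = (x <= y).
Proof. by case: k => //=; exact: lecR. Qed.

Lemma modulus0 k : modulus (0 : scalar_field R k) = 0.
Proof. by rewrite /modulus normr0 -scalar_mk0 scalar_mkK. Qed.

Lemma modulus_ge0 k (z : scalar_field R k) : 0 <= modulus z.
Proof. by rewrite -(ler_scalar_mk k) modulusE scalar_mk0. Qed.

Lemma modulus0_eq0 k (z : scalar_field R k) : modulus z = 0 -> z = 0.
Proof. by move=> z0; apply/normr0_eq0; rewrite -modulusE z0 scalar_mk0. Qed.

Lemma modulusD k (z w : scalar_field R k) :
  modulus (z + w) <= modulus z + modulus w.
Proof. by rewrite -(ler_scalar_mk k) scalar_mkD !modulusE ler_normD. Qed.

Lemma modulusM k (z w : scalar_field R k) : modulus (z * w) = modulus z * modulus w.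
Proof.
by rewrite -(scalar_mkK k (modulus z * _)) scalar_mkM !modulusE -normrM.
Qed.

End scalar_field.

Notation left_continuous f :=
  (forall x, f%function @ at_left x --> f%function x).

(* The library builds Lebesgue-Stieltjes measures from right continuous
   functions, with value h(y) - h(x) on ]x, y]. For a left continuous g take
   h(x) = - g(-x) and transport the measure of h along x |-> -x: the result
   has value g(y) - g(x) on [x, y[ (see [LS_measure_itv]). *)
Section LS_measure.
Context {R : realType} (g : R -> R).
Hypothesis (g_nd : nondecreasing g) (g_lc : left_continuous g).

Definition reflect_fun (x : R) : R := - g (- x).

Let reflect_nd : nondecreasing reflect_fun.
Proof. by move=> x y xy; rewrite /reflect_fun lerN2 g_nd// lerN2. Qed.

Let reflect_rc : right_continuous reflect_fun.
Proof.
move=> x; apply: (@cvgN _ R^o); apply/cvg_at_rightNP => /=.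
by rewrite /comp; under eq_fun do rewrite opprK; exact: g_lc.
Qed.

HB.instance Definition _ :=
  isCumulative.Build R _ R reflect_fun reflect_nd reflect_rc.

Let measurable_oppr : measurable_fun [set: measurableTypeR R]
  ((fun x => - x) : measurableTypeR R -> R).
Proof. exact: measurable_realfun.oppr_measurable. Qed.

Definition LS_measure : set R -> \bar R :=
  pushforward (lebesgue_stieltjes_measure reflect_fun)
    ((fun x => - x) : measurableTypeR R -> R).

HB.instance Definition _ := Measure.copy LS_measure
  (measure_function_pushforward__canonical__measure_function_Measure
    (lebesgue_stieltjes_measure reflect_fun) measurable_oppr).

Lemma LS_measure_itv (x y : R) : x <= y ->
  LS_measure `[x, y[ = (g y - g x)%:E.
Proof.
move=> xy; rewrite /LS_measure /= /pushforward.
rewrite (_ : _ @^-1` _ = `]- y, - x]%classic); last first.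
  apply/seteqP; split => z /=; rewrite !in_itv/= => /andP[? ?].
    by apply/andP; split; [rewrite ltrNl|rewrite lerNr].
  by apply/andP; split; [rewrite lerNr|rewrite ltrNl].
rewrite /lebesgue_stieltjes_measure /measure_extension/=.
rewrite measurable_mu_extE/=; last exact: is_ocitv.
by rewrite wlength_itv_bnd ?lerN2// /reflect_fun !opprK addrC.
Qed.

End LS_measure.


Section BCg.
Context {R : realType} (k : scalar_kind) (g : R -> R) (a b : R).

Definition segment := {x : R | x \in `[a, b]}.

Local Notation F := (scalar_field R k).
Implicit Types f : segment -> F.

Definition g_continuous f := forall (t : segment) (e : R), 0 < e ->
  exists2 d : R, 0 < d & forall s : segment,
    `|g (val t) - g (val s)| < d -> modulus (f t - f s) < e.

Definition bounded_on f := has_ubound (range (modulus \o f)).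

Definition in_BCg : {pred segment -> F} :=
  mem [set f | g_continuous f /\ bounded_on f].

(* BC_g([a, b]), with the supremum norm defined below. *)
Record BCg := MkBCg { BCg_val :> segment -> F ; _ : BCg_val \in in_BCg }.

HB.instance Definition _ := [isSub for BCg_val].
HB.instance Definition _ := [Choice of BCg by <:].

Let in_BCg_submod : submod_closed in_BCg.
Proof.
split=> [|l f1 f2].
  rewrite inE; split=> [t e e0|].
    by exists 1 => // s _; rewrite subrr modulus0.
  by exists 0 => _ [s _ <-] /=; rewrite modulus0.
rewrite !inE => -[c1 [M1 b1]] [c2 [M2 b2]]; split=> [t e e0|].
  have l0 : 0 < modulus l + 1 by rewrite ltr_wpDl ?modulus_ge0.
  have [|d1 d10 h1] := c1 t (e / 2 / (modulus l + 1)).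
    by rewrite !divr_gt0.
  have [|d2 d20 h2] := c2 t (e / 2); first by rewrite divr_gt0.
  exists (Num.min d1 d2); first by rewrite lt_min d10.
  move=> s; rewrite lt_min => /andP[/h1 s1 /h2 s2].
  rewrite /GRing.add /GRing.scale /=.
  rewrite [X in modulus X](_ : _ = l * (f1 t - f1 s) + (f2 t - f2 s)).
    2: by rewrite mulrBr opprD addrACA.
  rewrite (le_lt_trans (modulusD _ _))// (splitr e) ler_ltD// modulusM.
  rewrite (le_trans (ler_wpM2r (modulus_ge0 _) (_ : _ <= modulus l + 1)))//.
    by rewrite lerDl.
  by rewrite mulrC -ler_pdivlMr// ltW.
exists (modulus l * M1 + M2) => _ [s _ <-] /=.
rewrite (le_trans (modulusD _ _))// lerD//; last by apply: b2; exists s.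
by rewrite modulusM ler_wpM2l ?modulus_ge0//; apply: b1; exists s.
Qed.

HB.instance Definition _ := GRing.isSubmodClosed.Build _ _ in_BCg in_BCg_submod.
HB.instance Definition _ := [SubChoice_isSubLmodule of BCg by <:].

Definition BCg_sup (f : BCg) : R := sup (range (modulus \o f)).

Definition BCg_norm (f : BCg) : F := scalar_mk (BCg_sup f) 0.

Lemma BCg_has_ubound (f : BCg) : has_ubound (range (modulus \o f)).
Proof. by case: f => f /= ; rewrite inE => -[]. Qed.

Lemma modulus_le_BCg_sup (f : BCg) s : modulus (f s) <= BCg_sup f.
Proof. by apply: ub_le_sup; [exact: BCg_has_ubound|exists s]. Qed.

Lemma BCg_sup_le (f : BCg) (M : R) :
  0 <= M -> (forall s, modulus (f s) <= M) -> BCg_sup f <= M.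
Proof.
move=> M0 fM; rewrite /BCg_sup.
have [->|/set0P r0] := eqVneq (range (modulus \o f)) set0.
  by rewrite sup0.
by apply: ge_sup => // _ [s _ <-]; exact: fM.
Qed.

Lemma BCg_sup_ge0 (f : BCg) : 0 <= BCg_sup f.
Proof.
rewrite /BCg_sup.
have [->|/set0P[_ [s _ _]]] := eqVneq (range (modulus \o f)) set0.
  by rewrite sup0.
by rewrite (le_trans (modulus_ge0 (f s)))//; exact: modulus_le_BCg_sup.
Qed.

Let BCg_normD (f h : BCg) : BCg_norm (f + h) <= BCg_norm f + BCg_norm h.
Proof.
rewrite /BCg_norm -scalar_mkD ler_scalar_mk.
apply: BCg_sup_le => [|s]; first by rewrite addr_ge0 ?BCg_sup_ge0.
by rewrite (le_trans (modulusD _ _))// lerD ?modulus_le_BCg_sup.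
Qed.

Let BCg_normZ (l : F) (f : BCg) : BCg_norm (l *: f) = `|l| * BCg_norm f.
Proof.
rewrite /BCg_norm -modulusE -scalar_mkM; congr scalar_mk; apply/eqP.
rewrite eq_le; apply/andP; split.
  apply: BCg_sup_le => [|s]; first by rewrite mulr_ge0 ?modulus_ge0 ?BCg_sup_ge0.
  by rewrite modulusM ler_wpM2l ?modulus_ge0 ?modulus_le_BCg_sup.
have [->|l0] := eqVneq l 0; first by rewrite modulus0 mul0r BCg_sup_ge0.
have ml0 : 0 < modulus l.
  rewrite lt_neqAle modulus_ge0 andbT eq_sym; apply: contra_neq l0.
  exact: modulus0_eq0.
rewrite mulrC -ler_pdivlMr//; apply: BCg_sup_le => [|s].
  by rewrite divr_ge0 ?modulus_ge0 ?BCg_sup_ge0.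
rewrite ler_pdivlMr// mulrC -modulusM.
exact: (modulus_le_BCg_sup (l *: f) s).
Qed.

Let BCg_norm0_eq0 (f : BCg) : BCg_norm f = 0 -> f = 0.
Proof.
rewrite /BCg_norm -(scalar_mk0 k) => /(congr1 scalar_Re).
rewrite !scalar_mkK => f0; apply/val_inj/funext => s /=.
apply: modulus0_eq0; apply/eqP; rewrite eq_le modulus_ge0 andbT -f0.
exact: modulus_le_BCg_sup.
Qed.

HB.instance Definition _ :=
  Lmodule_isNormed.Build F BCg BCg_normD BCg_normZ BCg_norm0_eq0.

Lemma BCg_normE (f : BCg) :
  `|f| = scalar_mk (sup (range (modulus \o f))) 0 :> F.
Proof. by []. Qed.

End BCg.

Arguments in_BCg {R k} g {a b}.

Section Lp.
Context {R : realType} {k : scalar_kind}.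
Variable mu : {measure set R -> \bar R}.
Local Notation F := (scalar_field R k).
Implicit Types (D : set R) (p : \bar R) (f : R -> F).

Definition Lp_norm D p f : \bar R :=
  'N[mu]_p[EFin \o ((modulus \o f) \_ D)].

Definition in_Lp D p f : Prop :=
  [/\ measurable_fun D (scalar_Re \o f), measurable_fun D (scalar_Im \o f) &
      (Lp_norm D p f < +oo)%E].

Definition scalar_integral D f : F :=
  scalar_mk (\int[mu]_(s in D) scalar_Re (f s))
            (\int[mu]_(s in D) scalar_Im (f s)).

End Lp.

Section Wg.
Context {R : realType} {k : scalar_kind} {g : R -> R}.
Hypothesis (g_nd : nondecreasing g) (g_lc : left_continuous g).
Variables (a b : R) (p : \bar R).
Local Notation F := (scalar_field R k).
Local Notation mu_g := (LS_measure g_nd g_lc).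
Implicit Types (u : segment a b -> F) (v : R -> F).

Definition zero_ext u : R -> F := fun x => oapp u 0 (insub x).

Definition is_gderiv u v :=
  in_Lp mu_g `[a, b[ p v /\
  forall x : segment a b,
    u x = zero_ext u a + scalar_integral mu_g `[a, val x[ v.

(* W_g^{1,p}([a, b[), as a set of functions on [a, b]. *)
Definition Wg : set (segment a b -> F) :=
  [set u | in_Lp mu_g `[a, b[ p (zero_ext u) /\ exists v, is_gderiv u v].

(* Two functions v satisfying [is_gderiv u v] agree mu_g-a.e. on [a, b[, so
   the choice made here does not affect [Wg_norm]. *)
Definition gderiv u : R -> F := xget (fun=> 0) (is_gderiv u).

(* This is a norm exactly when g a < g b. If g a = g b then mu_g([a, b[) = 0, so
   the constant functions, which all belong to Wg and BCg, have norm 0, and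
   [Wg_compactly_embedded] fails. *)
Definition Wg_norm u : \bar R :=
  (Lp_norm mu_g `[a, b[ p (zero_ext u) + Lp_norm mu_g `[a, b[ p (gderiv u))%E.

(* The inclusion Wg -> BCg is well defined, and the image of every norm-bounded
   subset is relatively compact ([precompact] means that the closure is
   compact). *)
Definition Wg_compactly_embedded :=
  Wg `<=` [set` in_BCg g] /\
  forall B : set (segment a b -> F), B `<=` Wg ->
    (exists M : R, forall u, B u -> (Wg_norm u <= M%:E)%E) ->
    precompact [set f : BCg k g a b | B f].

End Wg.

Arguments Wg_compactly_embedded {R} k {g} g_nd g_lc a b p.

(* Main.v *)
Require Import Defs.
From mathcomp Require Import all_boot all_order all_algebra.
From mathcomp Require Import all_classical all_reals all_analysis.
From mathcomp Require Import measurable_realfun ring lra.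

(* By Hoelder's inequality |u(s) - u(t)| <= 2 ||u'||_p |g(s) - g(t)|^(1/q) with
   1/q = 1 - 1/p > 0, where the factor 2 comes from treating real and imaginary
   parts separately. Integrating |u| over [a, b[ then bounds sup |u|, since
   mu_g([a, b[) > 0. A bounded subset of W is thus uniformly bounded and
   uniformly equicontinuous for the pseudometric |g(s) - g(t)|, which is totally
   bounded on [a, b] because g is bounded there; Arzela-Ascoli concludes. *)

Set Implicit Arguments.
Unset Strict Implicit.

Import Order.TTheory GRing.Theory Num.Theory.
Import numFieldNormedType.Exports.
Local Open Scope classical_set_scope.
Local Open Scope ring_scope.

(** * Real and imaginary parts, and the modulus *)

Section scalar_field.
Context {R : realType} {k : scalar_kind}.
Implicit Types z w : scalar_field R k.

Lemma scalar_ReB z w : scalar_Re (z - w) = scalar_Re z - scalar_Re w.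
Proof. by case: k z w => //= -[? ?] [? ?]. Qed.

Lemma scalar_ImB z w : scalar_Im (z - w) = scalar_Im z - scalar_Im w.
Proof. by case: k z w => /= [_ _|[? ?] [? ?]//]; rewrite subr0. Qed.

Lemma scalar_mkDD (x x' y y' : R) :
  scalar_mk (x + x') (y + y') = scalar_mk x y + scalar_mk x' y'
    :> scalar_field R k.
Proof. by case: k. Qed.

Lemma modulus_distC z w : modulus (z - w) = modulus (w - z).
Proof. by rewrite /modulus distrC. Qed.

Lemma modulusE_sqrt z :
  modulus z = Num.sqrt (scalar_Re z ^+ 2 + scalar_Im z ^+ 2).
Proof.
by case: k z => /= [z|[x y]//]; rewrite expr0n/= addr0 sqrtr_sqr.
Qed.

Lemma normr_scalar_Re z : `|scalar_Re z| <= modulus z.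
Proof. by rewrite modulusE_sqrt -sqrtr_sqr ler_wsqrtr// lerDl sqr_ge0. Qed.

Lemma normr_scalar_Im z : `|scalar_Im z| <= modulus z.
Proof. by rewrite modulusE_sqrt -sqrtr_sqr ler_wsqrtr// lerDr sqr_ge0. Qed.

Lemma modulus_le_ReIm z : modulus z <= `|scalar_Re z| + `|scalar_Im z|.
Proof.
rewrite modulusE_sqrt -[leRHS]ger0_norm ?addr_ge0// -sqrtr_sqr ler_wsqrtr//.
rewrite sqrrD !real_normK ?num_real// addrAC.
by rewrite lerDl mulrn_wge0// mulr_ge0.
Qed.

(** For real scalars [scalar_mk] discards [y], and the second term is then mere slack, so both
    fields share one bound. *)
Lemma modulus_sub_mk_le z (x y : R) :
  modulus (z - scalar_mk x y) <= `|scalar_Re z - x| + `|scalar_Im z - y|.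
Proof.
rewrite (le_trans (modulus_le_ReIm _))// scalar_ReB scalar_ImB lerD//.
- by case: k z.
- by case: k z => //= z; rewrite subrr normr0.
Qed.

Lemma measurable_modulus d (T : measurableType d) (D : set T)
    (f : T -> scalar_field R k) :
  measurable_fun D (scalar_Re \o f) -> measurable_fun D (scalar_Im \o f) ->
  measurable_fun D (modulus \o f).
Proof.
move=> mRe mIm.
rewrite (_ : modulus \o f = fun x => Num.sqrt
    ((scalar_Re \o f) x ^+ 2 + (scalar_Im \o f) x ^+ 2)); last first.
  by apply/funext => x /=; rewrite modulusE_sqrt.
apply: (@measurableT_comp _ _ _ _ _ _ (@Num.sqrt R)); last first.
  by apply: measurable_funD; exact: measurable_funX.
by apply: continuous_measurable_fun; exact: sqrt_continuous.
Qed.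

End scalar_field.

(** * The Arzela-Ascoli theorem by ultrafilters *)

Lemma ultra_bounded_cvg {R : realType} (T : Type) (U : set_system T)
    (phi : T -> R) (M : R) :
  UltraFilter U -> U [set f | `|phi f| <= M] -> exists l : R, phi @ U --> l.
Proof.
move=> uU UM; have pU : ProperFilter U := @ultra_proper _ _ uU.
have [l [_ cl]] : exists l : R, (`[- M, M]%classic `&` cluster (phi @ U)) l.
  apply: segment_compact.
  change (U (phi @^-1` `[- M, M]%classic)).
  by apply: filterS UM => f /=; rewrite in_itv/= -ler_norml.
exists l; apply/cvgrPdist_lt => e e0.
(* An ultrafilter converges to each of its cluster points: otherwise it contains the complement of a
   ball around [l], which would have to meet that ball. *)
have [//|Ue] := in_ultra_setVsetC [set f | `|l - phi f| < e] uU.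
have [y [/= ny yl]] : ~` (ball l e) `&` ball l e !=set0.
  apply: cl; last exact: nbhsx_ballx.
  exact: Ue.
by [].
Qed.

Section Ascoli.
Context {R : realType} {k : scalar_kind} {g : R -> R} {a b : R}.
Hypotheses (g_nd : nondecreasing g) (ab : a <= b).
Local Notation F := (scalar_field R k).
Local Notation segment := (segment a b).

(** Real and imaginary parts converge separately. The limit is phrased with [modulus] and a real [e]
    because the norm of the scalar field takes its values in that field. *)
Lemma ultra_modulus_lim (T : Type) (U : set_system T) (phi : T -> F) (M : R) :
  UltraFilter U -> U [set f | modulus (phi f) <= M] ->
  exists l : F, forall e : R, 0 < e -> U [set f | modulus (phi f - l) < e].
Proof.
move=> uU UM; have pU : ProperFilter U := @ultra_proper _ _ uU.
have [|x /cvgrPdist_lt xl] := @ultra_bounded_cvg R T U (scalar_Re \o phi) M uU.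
  by apply: filterS UM => f /=; apply: le_trans; exact: normr_scalar_Re.
have [|y /cvgrPdist_lt yl] := @ultra_bounded_cvg R T U (scalar_Im \o phi) M uU.
  by apply: filterS UM => f /=; apply: le_trans; exact: normr_scalar_Im.
exists (scalar_mk x y) => e e0.
have e20 : 0 < e / 2 by rewrite divr_gt0.
apply: filterS2 (xl _ e20) (yl _ e20) => f /= xf yf.
rewrite (le_lt_trans (modulus_sub_mk_le _ _ _))// (splitr e) ltrD//.
  by rewrite distrC.
by rewrite distrC.
Qed.

(** Cut the range from [g a] to [g b] into slots of length [d] and pick a point of [segment] for
    each slot that [g] meets. Jumps of [g] only leave slots empty. *)
Lemma g_finite_net (d : R) : 0 < d -> exists (N : nat) (r : 'I_N -> segment),
  forall s : segment, exists i : 'I_N, `|g (val (r i)) - g (val s)| < d.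
Proof.
move=> d0.
have ain : a \in `[a, b] by rewrite in_itv/= lexx.
pose n (s : segment) := Num.trunc ((g (val s) - g a) / d).
have gs (s : segment) : 0 <= (g (val s) - g a) / d.
  rewrite divr_ge0 ?(ltW d0)// subr_ge0 g_nd//.
  by have := valP s; rewrite in_itv/= => /andP[].
pose N := (Num.trunc ((g b - g a) / d)).+1.
have nN s : (n s < N)%N.
  rewrite ltnS le_truncn// ler_pM2r ?invr_gt0// lerB// g_nd//.
  by have := valP s; rewrite in_itv/= => /andP[].
(* An empty slot receives the default point [a]; the slot of [s] contains [s], so its representative
   is genuine. *)
exists N, (fun i => xget (exist _ a ain) [set s | n s = i]) => s.
exists (Ordinal (nN s)); case: xgetP => /= [t _ nt|/(_ s)//].
have /andP[t1 t2] := truncn_itv (gs t).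
have /andP[s1 s2] := truncn_itv (gs s).
rewrite -/(n t) nt in t1 t2; rewrite -/(n s) in s1 s2.
(* After division by [d]: two reals with the same integer part differ by less than 1. *)
rewrite -(ltr_pM2r (_ : 0 < d^-1)) ?invr_gt0// mulfV ?gt_eqF//.
rewrite -[X in _ * X < _](@gtr0_norm _ d^-1) ?invr_gt0// -normrM.
rewrite (_ : (_ - _) * _ =
    (g (val t) - g a) / d - (g (val s) - g a) / d); last first.
  by rewrite -mulrBl opprB addrA subrK.
rewrite ltr_norml; move: t1 t2 s1 s2; rewrite -!natr1; lra.
Qed.

(* w is a prescribed choice e |-> delta of a g-equicontinuity rate. The last
   inequality is not strict so that the set is closed. *)
Definition equi_ball (M : R) (w : R -> R) : set (BCg k g a b) :=
  [set f | (forall s, modulus (f s) <= M) /\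
    forall e, 0 < e -> forall s t : segment,
      `|g (val s) - g (val t)| < w e -> modulus (f s - f t) <= e].

(** An ultrafilter on the set has a pointwise limit [h], which inherits the bound and the rate. The
    common rate and a finite net for [g] then make the convergence uniform. *)
Lemma compact_equi_ball (M : R) (w : R -> R) :
  (forall e, 0 < e -> 0 < w e) -> compact (equi_ball M w).
Proof.
move=> w0; rewrite compact_ultra => U uU UK.
have pU : ProperFilter U := @ultra_proper _ _ uU.
have /choice[h hU] (s : segment) : exists l : F, forall e, 0 < e ->
    U [set f : BCg k g a b | modulus (f s - l) < e].
  apply: (@ultra_modulus_lim _ U (fun f : BCg k g a b => f s) M) => //.
  by apply: filterS UK => f [+ _]; exact.
have hM s : modulus (h s) <= M.
  apply/ler_addgt0Pr => e e0.
  (* Closed conditions pass to [h] through a member of the ball that is close to [h] at the points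
     concerned. *)
  have [f [[fM _] /= fh]] := @filter_ex _ _ pU _ (filterI UK (hU s _ e0)).
  rewrite -(subrK (f s) (h s)) addrC (le_trans (modulusD _ _))// lerD//.
  by rewrite modulus_distC ltW.
have hw e : 0 < e -> forall s t : segment,
      `|g (val s) - g (val t)| < w e -> modulus (h s - h t) <= e.
  move=> e0 s t st; apply/ler_addgt0Pr => e' e'0.
  have e'20 : 0 < e' / 2 by rewrite divr_gt0.
  have [f [[[_ fw] /= fs] ft]] := @filter_ex _ _ pU _
    (filterI (filterI UK (hU s _ e'20)) (hU t _ e'20)).
  rewrite /= in ft.
  rewrite (_ : h s - h t = (f s - f t) + ((h s - f s) + (f t - h t))).
    2: by ring.
  rewrite (le_trans (modulusD _ _))// lerD ?fw// (splitr e').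
  by rewrite (le_trans (modulusD _ _))// lerD ?(ltW ft)// modulus_distC ltW.
have hB : h \in in_BCg g.
  rewrite inE; split=> [t e e0|]; last by exists M => _ [s _ <-]; exact: hM.
  (* The rate yields a non-strict bound, hence [e / 2] to get below [e] strictly. *)
  exists (w (e / 2)); first by rewrite w0 ?divr_gt0.
  move=> s st; rewrite (le_lt_trans (hw _ _ _ _ st)) ?divr_gt0//.
  by rewrite ltr_pdivrMr// ltr_pMr// ltr1n.
exists (MkBCg hB); split; first by split.
apply/cvgrPdist_le => /= e e0.
(* The norm of [BCg] is valued in the scalar field, so this [e] is a positive scalar; it is replaced
   by its real modulus [e']. *)
rewrite -(gtr0_norm e0) -modulusE; set e' := modulus e.
have {e0}e'0 : 0 < e'.
  rewrite lt_neqAle modulus_ge0 andbT eq_sym.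
  by apply: contra_neq (lt0r_neq0 e0); exact: modulus0_eq0.
have e30 : 0 < e' / 3 by rewrite divr_gt0.
have [N [r rP]] := @g_finite_net (w (e' / 3)) (w0 _ e30).
(* Finiteness of the net keeps this intersection in [U]. *)
have Ur : U [set f : BCg k g a b |
    forall i, modulus (f (r i) - h (r i)) < e' / 3].
  by apply: filter_forall => i; exact: hU.
apply: filterS2 UK Ur => f [_ fw] fr.
rewrite BCg_normE ler_scalar_mk; apply: BCg_sup_le => [|s]; first exact: ltW.
have [i is_] := rP s.
(* Three errors of [e' / 3]: the rate of [h], the distance of [f] to [h] at a net point, and the
   rate of [f]. *)
rewrite (_ : _ s = (h s - h (r i)) - (f (r i) - h (r i)) + (f (r i) - f s)).
  2: by rewrite -[LHS]/(h s - f s); ring.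
rewrite (_ : e' = e' / 3 + e' / 3 + e' / 3); last by field.
rewrite (le_trans (modulusD _ _))// lerD ?fw//.
rewrite (le_trans (modulusD _ _))// lerD//.
  by apply: hw => //; rewrite distrC.
by rewrite /modulus normrN; exact/ltW/fr.
Qed.
End Ascoli.

(* The inverse of the conjugate exponent of p; it is 1 for p = +oo. *)
Definition hoelder_exponent {R : realType} (p : \bar R) : R :=
  1 - fine (p^-1)%E.

Lemma hoelder_exponent_gt0 {R : realType} (p : \bar R) :
  (1 < p)%E -> 0 < hoelder_exponent p.
Proof.
rewrite /hoelder_exponent; case: p => [r||//]; last by rewrite invey subr0.
rewrite lte_fin inver => r1; rewrite (gt_eqF (lt_trans ltr01 r1))/=.
by rewrite subr_gt0 invf_lt1// (lt_trans ltr01).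
Qed.

(** * Hoelder's inequality against an indicator function *)

Section Lp_hoelder.
Context {R : realType} {k : scalar_kind}.
Variable mu : {measure set R -> \bar R}.
Local Notation F := (scalar_field R k).

Lemma Lnorm_indic (E : set R) (q : R) : measurable E -> 0 < q ->
  ('N[mu]_(q%:E)[EFin \o \1_E] = mu E `^ q^-1)%E.
Proof.
move=> mE q0; rewrite unlock; congr (_ `^ _)%E.
rewrite -[in RHS](setIT E) -integral_indic//; apply: eq_integral => x _ /=.
rewrite indicE; case: (x \in E) => /=; first by rewrite normr1 powR1.
by rewrite normr0 powR0// gt_eqF.
Qed.

(** For finite [p], Hoelder's inequality is applied to the restriction of |f| to [D] and to the
    indicator of [E]; for [p = +oo], |f| is bounded almost everywhere by its norm. *)
Lemma integral_modulus_le (D E : set R) (p : \bar R) (f : R -> F) :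
  measurable D -> measurable E -> E `<=` D -> (1 < p)%E -> in_Lp mu D p f ->
  (\int[mu]_(x in E) (modulus (f x))%:E <=
     Lp_norm mu D p f * mu E `^ hoelder_exponent p)%E.
Proof.
move=> mD mE ED p1 [mRe mIm fp].
have mf : measurable_fun D (modulus \o f) by exact: measurable_modulus.
have mfT : measurable_fun setT ((modulus \o f) \_ D).
  by apply/measurable_restrict => //; rewrite setTI.
case: p p1 fp => [r||//].
- rewrite lte_fin => r1 fp; rewrite /hoelder_exponent inver.
  have r0 : 0 < r by rewrite (lt_trans ltr01).
  rewrite (gt_eqF r0)/=.
  have q0 : 0 < 1 - r^-1 by rewrite subr_gt0 invf_lt1.
  (* The exponent is read as $1/q$ with $q = (1 - 1/r)^{-1}$, which turns the power of [mu E] into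
     the $L^q$ norm of the indicator. *)
  rewrite -[X in (_ `^ X)%E]invrK -Lnorm_indic ?invr_gt0//.
  apply: le_trans (hoelder mu mfT _ _ _ _) => //; last 2 first.
    by rewrite invr_gt0.
    by rewrite invrK addrC subrK.
  rewrite Lnorm1 [leLHS]integral_mkcond le_eqVlt; apply/orP; left.
  apply/eqP/eq_integral => x _; rewrite /patch/= indicE; case: ifPn => xE.
    have -> : x \in D by rewrite inE; apply: ED; rewrite inE in xE.
    by rewrite mulr1 ger0_norm// modulus_ge0.
  by rewrite mulr0 normr0.
- move=> _ fp; rewrite /hoelder_exponent invey/= subr0 poweRe1//.
  (* The norm at [+oo] is an essential supremum only if [mu] is nonzero; for the zero measure the
     whole line is negligible. *)
  have ae_le : \forall x \ae mu,
      ((((modulus \o f) \_ D) x)%:E <= Lp_norm mu D +oo f)%E.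
    rewrite /Lp_norm unlock; case: ifPn => [muT|].
      apply: filterS (ess_sup_inf.ess_sup_ge mu _) => x /=.
      by apply: le_trans; rewrite lee_fin ler_norm.
    rewrite -leNgt => muT; exists setT; split => //.
    by apply/eqP; rewrite eq_le muT measure_ge0.
  rewrite -integral_cst//.
  apply: ae_ge0_le_integral => //.
  + by move=> x _; rewrite lee_fin modulus_ge0.
  + by apply/measurable_EFinP; exact: measurable_funS mf.
  + by move=> x _; exact: Lnorm_ge0.
  + apply: filterS ae_le => x + /[dup] /ED Dx Ex; rewrite /patch.
    by rewrite mem_set.
Qed.
End Lp_hoelder.

(** * Integrals over subsets of a set of finite measure *)

Section Lp_integral.
Context {R : realType} {k : scalar_kind}.
Variable mu : {measure set R -> \bar R}.
Local Notation F := (scalar_field R k).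
Variables (D : set R) (p : \bar R) (f : R -> F).
Hypotheses (mD : measurable D) (Doo : (mu D < +oo)%E).
Hypotheses (p1 : (1 < p)%E) (fp : in_Lp mu D p f).

Lemma measurable_subset_fin (E : set R) : measurable E -> E `<=` D ->
  (mu E < +oo)%E.
Proof.
by move=> mE ED; apply: le_lt_trans Doo; rewrite le_measure ?inE.
Qed.

Lemma integral_modulus_fine_le (E : set R) : measurable E -> E `<=` D ->
  (\int[mu]_(x in E) (modulus (f x))%:E <=
   (fine (Lp_norm mu D p f) * fine (mu E) `^ hoelder_exponent p)%:E)%E.
Proof.
move=> mE ED; apply: le_trans (integral_modulus_le _ mE ED _ fp) _ => //.
rewrite EFinM -poweR_EFin !fineK ?ge0_fin_numE ?Lnorm_ge0 ?measure_ge0//.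
  exact: measurable_subset_fin.
by case: fp.
Qed.

(** On a set of finite measure $L^p$ lies in $L^1$: this is the preceding bound with [E] equal to
    [D]. *)
Lemma integrable_modulus : mu.-integrable D (EFin \o (modulus \o f)).
Proof.
have [mRe mIm _] := fp.
apply/integrableP; split; first exact/measurable_EFinP/measurable_modulus.
under eq_integral do rewrite /= ger0_norm ?modulus_ge0//.
by apply: le_lt_trans (integral_modulus_fine_le mD _) _; rewrite ?ltry.
Qed.

Lemma integrable_scalar_Re : mu.-integrable D (EFin \o (scalar_Re \o f)).
Proof.
have [mRe _ _] := fp; apply: le_integrable integrable_modulus => //.
  exact/measurable_EFinP.
by move=> x _; rewrite /= lee_fin (le_trans (normr_scalar_Re _))// ler_norm.
Qed.

Lemma integrable_scalar_Im : mu.-integrable D (EFin \o (scalar_Im \o f)).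
Proof.
have [_ mIm _] := fp; apply: le_integrable integrable_modulus => //.
  exact/measurable_EFinP.
by move=> x _; rewrite /= lee_fin (le_trans (normr_scalar_Im _))// ler_norm.
Qed.

(** Stated for any real [h] dominated by |f|, so that it serves both the real and the imaginary
    part. *)
Lemma normr_Rintegral_le (E : set R) (h : R -> R) :
  measurable E -> E `<=` D -> mu.-integrable D (EFin \o h) ->
  (forall x, `|h x| <= modulus (f x)) ->
  `|\int[mu]_(x in E) h x| <=
    fine (Lp_norm mu D p f) * fine (mu E) `^ hoelder_exponent p.
Proof.
move=> mE ED ih hf.
have ihE : mu.-integrable E (EFin \o h) by exact: integrableS ih.
have ifE := integrableS mD mE ED integrable_modulus.
apply: (le_trans (le_normr_Rintegral mE ihE)).
apply: (@le_trans _ _ (\int[mu]_(x in E) modulus (f x))).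
  apply: le_Rintegral => //.
  by have := integrable_abse ihE; apply: eq_integrable.
rewrite /Rintegral -lee_fin fineK; first exact: integral_modulus_fine_le.
exact: integrable_fin_num.
Qed.

Lemma modulus_scalar_integral_le (E : set R) : measurable E -> E `<=` D ->
  modulus (scalar_integral mu E f) <=
    2 * (fine (Lp_norm mu D p f) * fine (mu E) `^ hoelder_exponent p).
Proof.
(* The integral is a [scalar_mk], so [modulus_sub_mk_le] applies to its distance from 0. *)
move=> mE ED; rewrite -[scalar_integral _ _ _]subr0 modulus_distC.
rewrite (le_trans (modulus_sub_mk_le _ _ _))//.
rewrite mulr_natl mulr2n lerD// distrC.
- rewrite (_ : scalar_Re 0 = 0) ?subr0; last by case: (k).
  apply: normr_Rintegral_le => //; first exact: integrable_scalar_Re.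
  by move=> x; exact: normr_scalar_Re.
- rewrite (_ : scalar_Im 0 = 0) ?subr0; last by case: (k).
  apply: normr_Rintegral_le => //; first exact: integrable_scalar_Im.
  by move=> x; exact: normr_scalar_Im.
Qed.

Lemma scalar_integralU (A B : set R) : measurable A -> measurable B ->
  A `|` B `<=` D -> [disjoint A & B] ->
  scalar_integral mu (A `|` B) f =
  scalar_integral mu A f + scalar_integral mu B f.
Proof.
move=> mA mB ABD dAB; have mAB := measurableU _ _ mA mB.
rewrite /scalar_integral !Rintegral_setU//.
- exact: scalar_mkDD.
- exact: integrableS integrable_scalar_Im.
- exact: integrableS integrable_scalar_Re.
Qed.

End Lp_integral.

(** * Uniform estimates on the Stieltjes-Sobolev space *)

Section Wg.
Context {R : realType} {k : scalar_kind} {g : R -> R}.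
Hypothesis (g_nd : nondecreasing g) (g_lc : left_continuous g).
Variables (a b : R) (p : \bar R).
Hypotheses (ab : a < b) (gab : g a < g b) (p1 : (1 < p)%E).
Local Notation F := (scalar_field R k).
Local Notation mu := (LS_measure g_nd g_lc : {measure set R -> \bar R}).
Local Notation segment := (segment a b).
Local Notation al := (hoelder_exponent p).

Let mu_itv (x y : R) : x <= y -> mu `[x, y[%classic = (g y - g x)%:E.
Proof. exact: LS_measure_itv. Qed.

Let mu_ab_fin : (mu `[a, b[%classic < +oo)%E.
Proof. by rewrite mu_itv ?ltry// ltW. Qed.

(** For $t \le s$ the difference is the integral of [v] over $[t,s)$, whose mass is $g(s) -
    g(t)$. *)
Lemma gderiv_hoelder (u : segment -> F) (v : R -> F) (s t : segment) :
  is_gderiv g_nd g_lc p u v ->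
  modulus (u s - u t) <=
    2 * fine (Lp_norm mu `[a, b[ p v) * `|g (val s) - g (val t)| `^ al.
Proof.
move=> [vp uE]; wlog st : s t / val t <= val s => [wlg|].
  have [|/ltW] := leP (val t) (val s); first exact: wlg.
  by move=> /wlg; rewrite modulus_distC distrC.
have /[!in_itv]/= /andP[a_s s_b] := valP s.
have /[!in_itv]/= /andP[a_t t_b] := valP t.
have sb : `[a, val s[ `<=` `[a, b[.
  by apply: subset_itvl; rewrite bnd_simp.
have split_s :
    `[a, val s[%classic = `[a, val t[%classic `|` `[val t, val s[%classic.
  by rewrite -itv_bndbnd_setU ?bnd_simp.
have -> : u s - u t = scalar_integral mu `[val t, val s[ v.
  rewrite (uE s) (uE t) opprD addrACA subrr add0r split_s.
  rewrite (scalar_integralU _ _ p1 vp) -?split_s//.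
    by rewrite addrAC subrr add0r.
  apply/disj_setPS => x [/=]; rewrite !in_itv/= => /andP[_ xt] /andP[tx _].
  by have := lt_le_trans xt tx; rewrite ltxx.
have := modulus_scalar_integral_le _ mu_ab_fin p1 vp (E := `[val t, val s[).
rewrite mu_itv//= mulrA ger0_norm ?subr_ge0 ?g_nd//; apply => //.
by apply: subset_itv; rewrite bnd_simp.
Qed.

(** By [gderiv_hoelder], |u(s)| minus the largest possible oscillation, called [c] below, is at most
    |u(x)| for every [x] in $[a,b)$. Integrating over [x] and dividing by the mass [g b - g a]
    leaves the mean of |u|, which Hoelder's inequality bounds. *)
Lemma Wg_sup_le (u : segment -> F) (v : R -> F) (s : segment) :
  in_Lp mu `[a, b[ p (zero_ext u) -> is_gderiv g_nd g_lc p u v ->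
  modulus (u s) <= fine (Lp_norm mu `[a, b[ p (zero_ext u)) *
      (g b - g a) `^ al / (g b - g a) +
    2 * fine (Lp_norm mu `[a, b[ p v) * (g b - g a) `^ al.
Proof.
move=> up uv; rewrite -lerBlDr ler_pdivlMr ?subr_gt0//.
set c := _ - _.
have g0 : 0 < g b - g a by rewrite subr_gt0.
have cu (x : R) : x \in `[a, b[ -> c <= modulus (zero_ext u x).
  move=> xab.
  have xab' : x \in `[a, b].
    by move: xab; rewrite !in_itv/= => /andP[-> /ltW].
  rewrite /zero_ext insubT/= -/(segment) lerBlDr -lerBlDl.
  set t := Sub _ _.
  apply: (@le_trans _ _ (modulus (u s - u t))).
    by rewrite lerBlDl (le_trans _ (modulusD _ _))// addrC subrK.
  apply: (le_trans (gderiv_hoelder s t uv)); rewrite ler_wpM2l//.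
    by rewrite mulr_ge0// fine_ge0// Lnorm_ge0.
  rewrite ge0_ler_powR ?nnegrE ?(ltW g0) ?(ltW (hoelder_exponent_gt0 p1))//.
  have /[!in_itv]/= /andP[a_s s_b] := valP s.
  have /[!in_itv]/= /andP[a_t t_b] := xab'.
  have := g_nd a_s; have := g_nd s_b.
  have := g_nd a_t; have := g_nd t_b.
  by rewrite ler_norml; lra.
have mab := measurable_itv `[a, b[.
have := integral_modulus_fine_le mab mu_ab_fin p1 up mab (@subset_refl _ _).
rewrite mu_itv ?(ltW ab)//= -lee_fin; apply: le_trans.
rewrite EFinM -(mu_itv (ltW ab)) -integral_cst//.
(* The constant [c] may be negative, so integrable rather than nonnegative functions are
   compared. *)
apply: le_integral => //.
- apply/integrableP; split; first exact: measurable_cst.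
  by rewrite integral_cst// mu_itv ?(ltW ab)// -EFinM ltry.
- exact: (integrable_modulus _ mu_ab_fin p1 up).
- by move=> x; rewrite inE/= lee_fin => /cu.
Qed.

(** Inverts the Hoelder modulus of continuity to get a [delta] for each [e]; the [+ 1] avoids
    dividing by zero when [C = 0]. *)
Lemma powR_modulus_lt (C e x : R) : 0 <= C -> 0 < e -> 0 <= x ->
  x < (e / (C + 1)) `^ al^-1 -> C * x `^ al < e.
Proof.
move=> C0 e0 x0 xe; have al0 := hoelder_exponent_gt0 p1.
have C10 : 0 < C + 1 by rewrite ltr_wpDl.
have ec0 : 0 < e / (C + 1) by rewrite divr_gt0.
have : x `^ al < e / (C + 1).
  have -> : e / (C + 1) = ((e / (C + 1)) `^ al^-1) `^ al.
    by rewrite -powRrM mulVf ?powRr1 ?(ltW ec0)// lt0r_neq0.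
  by rewrite gt0_ltr_powR// ?nnegrE ?powR_ge0.
rewrite ltr_pdivlMr// mulrDr mulr1 mulrC; apply: le_lt_trans.
by rewrite lerDl powR_ge0.
Qed.

Lemma Wg_sub_BCg : Wg g_nd g_lc p `<=` [set` (in_BCg g : {pred segment -> F})].
Proof.
move=> u [up [v uv]]; rewrite /= inE; split.
  move=> t e e0; set C := 2 * fine (Lp_norm mu `[a, b[ p v).
  have C0 : 0 <= C by rewrite mulr_ge0// fine_ge0// Lnorm_ge0.
  exists ((e / (C + 1)) `^ al^-1).
    by rewrite powR_gt0// divr_gt0// ltr_wpDl.
  move=> s st; apply: le_lt_trans (gderiv_hoelder t s uv) _.
  exact: powR_modulus_lt.
by eexists => _ [s _ <-]; exact: Wg_sup_le uv.
Qed.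

Lemma Wg_norm_le (u : segment -> F) (M : R) : Wg g_nd g_lc p u ->
  (Wg_norm g_nd g_lc p u <= M%:E)%E ->
  [/\ is_gderiv g_nd g_lc p u (gderiv g_nd g_lc p u),
      fine (Lp_norm mu `[a, b[ p (zero_ext u)) <= M &
      fine (Lp_norm mu `[a, b[ p (gderiv g_nd g_lc p u)) <= M].
Proof.
move=> [up [v uv]] uM.
have gu : is_gderiv g_nd g_lc p u (gderiv g_nd g_lc p u).
  by apply: xgetPex; exists v.
have [[_ _ gfin] _] := gu; have [_ _ ufin] := up.
split => //; rewrite -lee_fin fineK ?ge0_fin_numE ?Lnorm_ge0//.
- by apply: le_trans uM; rewrite leeDl// Lnorm_ge0.
- by apply: le_trans uM; rewrite leeDr// Lnorm_ge0.
Qed.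

Lemma Wg_bounded_precompact (B : set (segment -> F)) (M : R) :
  B `<=` Wg g_nd g_lc p ->
  (forall u, B u -> (Wg_norm g_nd g_lc p u <= M%:E)%E) ->
  precompact [set f : BCg k g a b | B f].
Proof.
move=> BW BM; have M0 : 0 <= 2 * `|M| by rewrite mulr_ge0.
(* The rate comes from [powR_modulus_lt] and the radius [S] from [Wg_sup_le], with both norms
   replaced by |M|; the absolute value covers a negative [M], possible when [B] is empty. *)
pose w e := (e / (2 * `|M| + 1)) `^ al^-1.
pose S := `|M| * (g b - g a) `^ al / (g b - g a) + 2 * `|M| * (g b - g a) `^ al.
apply: (@precompact_subset _ _ (equi_ball S w)); last first.
  apply: compact_precompact; first exact: norm_hausdorff.
  apply: (compact_equi_ball g_nd (ltW ab)) => e e0.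
  by rewrite powR_gt0// divr_gt0// ltr_wpDl.
move=> f /= Bf; have [gu uM vM] := Wg_norm_le (BW _ Bf) (BM _ Bf).
have {}uM := le_trans uM (ler_norm M); have {}vM := le_trans vM (ler_norm M).
have [up _] := BW _ Bf; split=> [s|e e0 s t st].
  apply: le_trans (Wg_sup_le s up gu) _; rewrite lerD//.
    by rewrite !ler_wpM2r ?powR_ge0// invr_ge0 subr_ge0 ltW.
  by rewrite ler_wpM2r ?powR_ge0// ler_wpM2l.
apply: le_trans (gderiv_hoelder s t gu) _.
apply: (@le_trans _ _ (2 * `|M| * `|g (val s) - g (val t)| `^ al)).
  by rewrite ler_wpM2r ?powR_ge0// ler_wpM2l.
exact/ltW/powR_modulus_lt.
Qed.

End Wg.

Unset Implicit Arguments.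

(** [hg] excludes the degenerate case in which the constants have norm 0 yet form an unbounded set
    in [BCg]. *)
Theorem theorem5p7 (R : realType) (k : scalar_kind) (g : R -> R)
    (g_nd : nondecreasing g) (g_lc : left_continuous g)
    (a b : R) (hab : a < b) (hg : g a < g b)
    (p : \bar R) (hp : (1 < p)%E) :
  Wg_compactly_embedded k g_nd g_lc a b p.
Proof.
split; first exact: Wg_sub_BCg.
by move=> B BW [M BM]; exact: Wg_bounded_precompact BM.
Qed.
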